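(* For every complex polynomial $F=Z^n+c_1Z^{n-1}+\dots+c_n$ in $\mathbb{C}[Z]$ there exist complex roots $z_1,\dots,z_n\in\mathbb{C}$ such that $F=(Z-z_1)\cdots(Z-z_n)$, and the algebraic winding number provides an algorithm to locate them. Starting from some rectangle containing all $n$ roots (for instance any rectangle containing the Cauchy disk of $F$), we can subdivide and keep only those rectangles that actually contain roots, using the fact that the algebraic winding number of $F$ along the boundary of a rectangle counts the roots of $F$ in it. All computations can be carried out using Sturm chains. By iterated bisection we can thus approximate all roots to any desired precision.
   Context: Rectangles are sets $\Gamma=[x_0,x_1]\times[y_0,y_1]\subset\mathbb{C}=\mathbb{R}^2$ with $x_0<x_1$, $y_0<y_1$. In this setting the field operations and the comparisons $a=b$, $a<b$ of real numbers are considered as primitive operations. Algebraic winding number: for nonzero $f\in\mathbb{R}(X)$ and $a<b$, the Cauchy index is $\operatorname{Ind}_a^b(f)=\operatorname{Ind}_a^+(f)+\sum_{a<x<b}(\operatorname{Ind}_x^+(f)-\operatorname{Ind}_x^-(f))-\operatorname{Ind}_b^-(f)$, where $\operatorname{Ind}_x^{\pm}(f)$ is $+\frac12$, $-\frac12$ or $0$ according to whether the right/left limit of $f$ at $x$ is $+\infty$, $-\infty$ or finite; it is $0$ for $\frac UV$ with $U=0$ or $V=0$. For a rectangle $\Gamma$ with positively oriented boundary traversed along its four edges by affine parametrizations $\gamma_1,\dots,\gamma_4\colon[0,1]\to\mathbb{C}$, put $w(F|\partial\Gamma)=\frac12\sum_{j=1}^4\operatorname{Ind}_0^1\bigl(\frac{\operatorname{re}(F\circ\gamma_j)}{\operatorname{im}(F\circ\gamma_j)}\bigr)$.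 Root counting: if $F$ does not vanish at any of the four vertices of $\Gamma$, then $w(F|\partial\Gamma)$ equals the number of roots of $F$ in $\Gamma$, where each root in the interior is counted with its multiplicity and each root in an edge is counted with half its multiplicity. Cauchy disk: with $\rho_F=1+\max\{|c_1|,\dots,|c_n|\}$, the Cauchy disk is $\{z\in\mathbb{C}:|z|<\rho_F\}$; every rectangle $\Gamma$ containing it satisfies $w(F|\partial\Gamma)=n$. Sturm chains: sequences of polynomials produced by iterated euclidean division $P_{k-1}=Q_kP_k-P_{k+1}$ (with sign-changed remainders); the difference of the numbers of sign changes of such a chain at the two endpoints of an interval computes the Cauchy index there without knowledge of the roots. *)

(* Defs.v *)
From HB Require Import structures.
From mathcomp Require Import all_boot all_order all_algebra.
From mathcomp Require Import all_classical all_reals all_analysis.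
From mathcomp Require Export complex.

Set Implicit Arguments.
Unset Strict Implicit.
Unset Printing Implicit Defensive.

Import Order.TTheory GRing.Theory Num.Theory.
Import numFieldNormedType.Exports.

Local Open Scope classical_set_scope.
Local Open Scope complex_scope.
Local Open Scope ring_scope.

(* Everything up to [approx_roots] is stated over an arbitrary ordered field K
   and is a program whose primitive steps are the field operations and the
   comparisons of K: no limit, no root and no choice enters.  The analytic
   notions (Cauchy index, winding number) come after it and need the reals. *)

Record rect (K : Type) := Rect { xmin : K; xmax : K; ymin : K; ymax : K }.

Section RectEq.
Variable K : eqType.
Definition tuple_of_rect (G : rect K) :=
  (xmin G, xmax G, ymin G, ymax G).
Definition rect_of_tuple (t : K * K * K * K) :=
  let: (x0, x1, y0, y1) := t in Rect x0 x1 y0 y1.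
Lemma tuple_of_rectK : cancel tuple_of_rect rect_of_tuple.
Proof. by case. Qed.
HB.instance Definition _ := Equality.copy (rect K) (can_type tuple_of_rectK).
End RectEq.

Section OrderedField.
Variable K : realFieldType.
Implicit Types (G : rect K) (F : {poly K[i]}) (P : {poly K[i]})
               (p q U V : {poly K}).

Definition is_rect G : bool := (xmin G < xmax G) && (ymin G < ymax G).

Definition in_rect G (z : K[i]) : bool :=
  (xmin G <= complex.Re z <= xmax G) && (ymin G <= complex.Im z <= ymax G).

Definition in_interior G (z : K[i]) : bool :=
  (xmin G < complex.Re z < xmax G) && (ymin G < complex.Im z < ymax G).

(* The contribution of a root z to the winding number, when z is not a vertex *)
Definition root_weight G (z : K[i]) : K :=
  if in_interior G z then 1 else if in_rect G z then 2^-1 else 0.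

(* The vertices, counterclockwise from the lower left one *)
Definition vertices G : seq K[i] :=
  [:: xmin G +i* ymin G; xmax G +i* ymin G; xmax G +i* ymax G;
      xmin G +i* ymax G].

(* The segments from one vertex to the next, as (origin, end) pairs *)
Definition edges G : seq (K[i] * K[i]) :=
  zip (vertices G) (rot 1 (vertices G)).

Definition center G : K[i] :=
  ((xmin G + xmax G) / 2) +i* ((ymin G + ymax G) / 2).

(* F o gamma, where gamma(t) = a + t (b - a) and e = (a, b) *)
Definition along F (e : K[i] * K[i]) : {poly K[i]} :=
  F \Po (e.1%:P + (e.2 - e.1) *: 'X).

(* For t in K, (re_poly P).[t] is the real part of P.[t%:C] *)
Definition re_poly P : {poly K} := \poly_(k < size P) complex.Re P`_k.
Definition im_poly P : {poly K} := \poly_(k < size P) complex.Im P`_k.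

(* The chain P_0 = p, P_1 = q, P_{k-1} = Q_k P_k - P_{k+1}, up to the last
   nonzero remainder.  (size q).+1 steps of fuel suffice when q follows p. *)
Fixpoint sturm_rec (fuel : nat) p q : seq {poly K} :=
  if fuel is m.+1 then
    if q == 0 then [:: p] else p :: sturm_rec m q (- (p %% q))
  else [::].

(* The chain of the fraction U / V; dividing by the gcd first makes its last
   term a constant, which matters when U and V have common zeros at the
   endpoints. *)
Definition sturm_chain U V : seq {poly K} :=
  let d := gcdp U V in sturm_rec (size (U %/ d)).+1 (V %/ d) (U %/ d).

(* A passage between a nonzero value and zero counts as half a sign change *)
Definition sign_changes (s : seq K) : K :=
  \sum_(k < (size s).-1) `|Num.sg s`_k - Num.sg s`_k.+1| / 2.

Definition sturm_index U V (a b : K) : K :=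
  let s := sturm_chain U V in
  sign_changes [seq p.[a] | p <- s] - sign_changes [seq p.[b] | p <- s].

Definition sturm_winding F G : K :=
  (\sum_(e <- edges G)
     sturm_index (re_poly (along F e)) (im_poly (along F e)) 0 1) / 2.

(* The winding number counts roots only if no vertex is a root, hence the
   separate test of the four vertices. *)
Definition contains_root F G : bool :=
  has (fun v => F.[v] == 0) (vertices G) || (0 < sturm_winding F G).

Definition quarters G : seq (rect K) :=
  let: Rect x0 x1 y0 y1 := G in
  let xm := (x0 + x1) / 2 in
  let ym := (y0 + y1) / 2 in
  [:: Rect x0 xm y0 ym; Rect xm x1 y0 ym; Rect x0 xm ym y1; Rect xm x1 ym y1].

Definition keep F (s : seq (rect K)) : seq (rect K) :=
  [seq G <- s | contains_root F G].

Definition bisect F (s : seq (rect K)) : seq (rect K) :=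
  keep F (flatten [seq quarters G | G <- s]).

Definition locate F G (k : nat) : seq (rect K) :=
  iter k (bisect F) (keep F [:: G]).

Definition approx_roots F G (k : nat) : seq K[i] :=
  [seq center H | H <- locate F G k].

End OrderedField.

Section Reals.
Variable R : realType.
Implicit Types (f : R -> R) (U V : {poly R}) (F : {poly R[i]}) (G : rect R).

(* The index at x of f along the filter l, which is x^'+ or x^'- *)
Definition ind_along f (l : set_system R) : R :=
  if `[< f t @[t --> l] --> +oo >] then 2^-1
  else if `[< f t @[t --> l] --> -oo >] then - 2^-1
  else 0.

(* The Cauchy index of U / V.  If U = 0 or V = 0 the function below vanishes
   identically, and so does its index. *)
Definition cauchy_index U V (a b : R) : R :=
  let f t := U.[t] / V.[t] in
  ind_along f a^'+
  + \sum_(x \in `]a, b[) (ind_along f x^'+ - ind_along f x^'-)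
  - ind_along f b^'-.

Definition winding F G : R :=
  (\sum_(e <- edges G)
     cauchy_index (re_poly (along F e)) (im_poly (along F e)) 0 1) / 2.

(* rho_F for the monic polynomial with coefficients c_1, ..., c_n *)
Definition cauchy_radius n (c : 'I_n -> R[i]) : R :=
  1 + \big[Num.max/0]_(i < n) Normc.normc (c i).

End Reals.

(* Main.v *)
Require Import Defs.
From mathcomp Require Import all_boot all_order all_algebra.
From mathcomp Require Import all_classical all_reals all_analysis.
From mathcomp Require Import complex.
From mathcomp Require Import polyrcf.
From mathcomp Require Import ring lra.

(* Over the reals, write the one-sided index of p/q at x, for p and q without
   common root, as [q(x) = 0] sg(pq)/2, the sign being taken on the side
   considered.  The signs of a polynomial g on both sides of the points of an
   interval telescope, because g has no sign change between consecutive roots.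
   Every identity between indices thus reduces to a local identity between
   signs.  Two of them suffice:
   - inversion: Ind(p/q) + Ind(q/p) = (sg(pq)(b) - sg(pq)(a)) / 2, which turns
     the Euclidean algorithm into Sturm's computation of the index;
   - product: for u = p + iq and v = r + is, the index of uv is the sum of the
     indices of u and v, minus the variation of sg(Im u Im v Im uv) / 2.
   Along the closed boundary of a rectangle the variations of the product
   formula cancel, so the winding number is additive on products, and it remains
   to compute it for Z - z.  The splitting of F is the algebraic closedness of
   R[i]. *)

Set Implicit Arguments.
Unset Strict Implicit.
Unset Printing Implicit Defensive.

Import Order.TTheory GRing.Theory Num.Theory.
Import numFieldNormedType.Exports.

Local Open Scope complex_scope.
Local Open Scope ring_scope.

(** * Signs of a polynomial on either side of a point *)

Section Germs.
Variable R : realType.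
Implicit Types (p q r g : {poly R}) (x a b : R) (l : set_system R).

(** All that is used of the right and left neighbourhoods of [x], so that both sides are treated at
    once. The constant nonzero sign of [y - x] also keeps [y] away from [x]. *)
Definition one_sided x l :=
  [/\ ProperFilter l, (l --> x)%classic
    & exists2 e : R, e != 0 & \forall y \near l, Num.sg (y - x) = e].

Lemma one_sided_right x : one_sided x (x^'+)%classic.
Proof.
split; [exact: _ | exact: (@cvg_within _ (nbhs x)) |].
exists 1; first exact: oner_neq0.
near=> y; rewrite gtr0_sg // subr_gt0.
by near: y; exact: nbhs_right_gt.
Unshelve. all: by end_near. Qed.

Lemma one_sided_left x : one_sided x (x^'-)%classic.
Proof.
split; [exact: _ | exact: (@cvg_within _ (nbhs x)) |].
exists (-1); first by rewrite oppr_eq0 oner_neq0.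
near=> y; rewrite ltr0_sg // subr_lt0.
by near: y; exact: nbhs_left_lt.
Unshelve. all: by end_near. Qed.

(** The eventual sign of [p] along [l], chosen with default 0; [near_sg_along] shows that it exists
    on one-sided filters. *)
Definition sg_along p l : R :=
  xget 0 [set s | \forall y \near l, Num.sg p.[y] = s]%classic.

Section OneSided.
Variables (x : R) (l : set_system R).
Hypothesis lP : one_sided x l.

Let l_proper : ProperFilter l. Proof. by case: lP. Qed.
#[local] Existing Instance l_proper.

Lemma cvg_horner p : (p.[y] @[y --> l] --> p.[x])%classic.
Proof.
have [_ lx _] := lP.
exact: cvg_trans (cvg_app _ lx) (@continuous_horner _ p x).
Qed.

Lemma near_sg_nonroot p : p.[x] != 0 -> \forall y \near l, Num.sg p.[y] = Num.sg p.[x].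
Proof.
have cp := @cvg_horner p.
rewrite neq_lt => /orP[px|px].
  near=> y; rewrite (ltr0_sg px) ltr0_sg //.
  by near: y; exact: (cvgr_lt _ cp).
near=> y; rewrite (gtr0_sg px) gtr0_sg //.
by near: y; exact: (cvgr_gt _ cp).
Unshelve. all: by end_near. Qed.

(** Write [p = q (X - x)^m] with [q(x)] nonzero: near [x] the sign is that of [q(x)] times the
    [m]-th power of the sign of the side. *)
Lemma near_sg_along p : \forall y \near l, Num.sg p.[y] = sg_along p l.
Proof.
suff [s sP] : exists s, \forall y \near l, Num.sg p.[y] = s.
  by rewrite /sg_along; case: xgetP => [t _ //|/(_ s)/(_ sP)].
have [_ _ [e _ ex]] := lP.
have [->|p0] := eqVneq p 0.
  by exists 0; near=> y; rewrite horner0 sgr0.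
have [m [q]] := multiplicity_XsubC p x.
rewrite p0 /= => qx ->.
exists (Num.sg q.[x] * e ^+ m).
have nq : \forall y \near l, Num.sg q.[y] = Num.sg q.[x].
  exact: near_sg_nonroot.
near=> y; rewrite hornerM horner_exp hornerXsubC sgrM sgrX.
by congr (_ * _ ^+ _); near: y.
Unshelve. all: by end_near. Qed.

Lemma sg_along_unique p s : (\forall y \near l, Num.sg p.[y] = s) -> sg_along p l = s.
Proof.
move=> ps; near l => y.
have <- : Num.sg p.[y] = sg_along p l by near: y; exact: near_sg_along.
by near: y.
Unshelve. all: by end_near. Qed.

Lemma sg_alongM p q : sg_along (p * q) l = sg_along p l * sg_along q l.
Proof.
apply: sg_along_unique; near=> y.
rewrite hornerM sgrM; congr (_ * _); near: y; exact: near_sg_along.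
Unshelve. all: by end_near. Qed.

Lemma sg_along_nonroot p : p.[x] != 0 -> sg_along p l = Num.sg p.[x].
Proof. by move=> px; apply: sg_along_unique; exact: near_sg_nonroot. Qed.

Lemma sg_along0 : sg_along 0 l = 0.
Proof. by apply: sg_along_unique; near=> y; rewrite horner0 sgr0.
Unshelve. all: by end_near. Qed.

Lemma sg_alongN p : sg_along (- p) l = - sg_along p l.
Proof.
apply: sg_along_unique; near=> y; rewrite hornerN sgrN; congr (- _).
near: y; exact: near_sg_along.
Unshelve. all: by end_near. Qed.

Lemma near_nonroot p : p != 0 -> \forall y \near l, p.[y] != 0.
Proof.
move=> p0; have [_ _ [e e0 ex]] := lP.
have [m [q]] := multiplicity_XsubC p x.
rewrite p0 /= => qx ->.
have nq : \forall y \near l, Num.sg q.[y] = Num.sg q.[x] by exact: near_sg_nonroot.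
near=> y; rewrite hornerM horner_exp hornerXsubC mulf_neq0 ?expf_neq0 //.
  by rewrite -sgr_eq0 (near nq y) // sgr_eq0.
by rewrite -sgr_eq0 (near ex y).
Unshelve. all: by end_near. Qed.

(** Where [q(x)] is nonzero the limit is finite. Where a nonzero [q] vanishes, the inverse fraction
    tends to 0 with a constant sign, which decides between the two infinities. *)
Lemma ind_alongE p q : ~~ (root p x && root q x) ->
  ind_along (fun t => p.[t] / q.[t]) l = (q.[x] == 0)%:R * sg_along (p * q) l / 2.
Proof.
rewrite /root negb_and => pq; rewrite /ind_along.
have fin (c : R) (f : R -> R) : (f @ l --> c)%classic ->
    `[< (f @ l --> +oo)%classic >] = false /\ `[< (f @ l --> -oo)%classic >] = false.
  move=> fc; split; apply/asboolPn => fo.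
    near l => y; have h1 : f y < c + 1.
      by near: y; apply: (cvgr_lt _ fc); rewrite ltrDl.
    have h2 : c + 1 < f y by near: y; exact: (proj1 (cvgryPgt f) fo (c + 1)).
    by have := lt_trans h1 h2; rewrite ltxx.
  near l => y; have h1 : f y > c - 1.
    by near: y; apply: (cvgr_gt _ fc); rewrite ltrBlDr ltrDl.
  have h2 : f y < c - 1 by near: y; exact: (proj1 (cvgrNyPlt f) fo (c - 1)).
  by have := lt_trans h1 h2; rewrite ltxx.
have [qx|qx] := eqVneq q.[x] 0; last first.
  have /fin[-> ->] : (p.[t] / q.[t] @[t --> l] --> p.[x] / q.[x])%classic.
    by apply: cvgM; [exact: cvg_horner|apply: cvgV => //; exact: cvg_horner].
  by rewrite !mul0r.
(* Division by 0 gives 0, so for [q = 0] the fraction is the zero function, in accordance with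
   [sg_along 0 l = 0]. *)
have [->|q0] := eqVneq q 0.
  have /fin[-> ->] : (p.[t] / (0 : {poly R}).[t] @[t --> l] --> 0)%classic.
    by under eq_fun do rewrite horner0 invr0 mulr0; exact: cvg_cst.
  by rewrite mulr0 sg_along0 mulr0 mul0r.
have px : p.[x] != 0 by move: pq; rewrite qx eqxx orbF.
have p0 : p != 0 by apply: contra_neq px => ->; rewrite horner0.
rewrite mul1r.
have := near_nonroot (mulf_neq0 p0 q0) => npq.
have npqs := near_sg_along (p * q).
have fV : ((p.[t] / q.[t])^-1 @[t --> l] --> (0 : R))%classic.
  rewrite (_ : 0 = q.[x] / p.[x]); last by rewrite qx mul0r.
  under eq_fun do rewrite invfM invrK mulrC.
  by apply: cvgM; [exact: cvg_horner|apply: cvgV => //; exact: cvg_horner].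
have nsg : \forall t \near l, Num.sg (p.[t] / q.[t]) = sg_along (p * q) l.
  near=> t; rewrite -(near npqs t) // hornerM !sgrM sgrV; congr (_ * _).
have snz : sg_along (p * q) l != 0.
  near l => t; rewrite -(near npqs t) // sgr_eq0; exact: (near npq t).
have sgcase : sg_along (p * q) l = 1 \/ sg_along (p * q) l = -1.
  near l => t; move: snz; rewrite -(near npqs t) //.
  by case: sgrP; rewrite ?eqxx => // _ _; [left|right].
case: sgcase => sE; rewrite sE in nsg *.
  have fy : (p.[t] / q.[t] @[t --> l] --> +oo)%classic.
    apply/(@gtr0_cvgV0 _ _ l _ (fun t => p.[t] / q.[t])) => //.
    by near=> t; rewrite -sgr_gt0 (near nsg t).
  by rewrite asboolT // mul1r.
have fy : (p.[t] / q.[t] @[t --> l] --> -oo)%classic.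
  apply/(@ltr0_cvgV0 _ _ l _ (fun t => p.[t] / q.[t])) => //.
  by near=> t; rewrite -sgr_lt0 (near nsg t) // ltrN10.
(* [ind_along] tests [+oo] first, so this limit has to be excluded. *)
rewrite asboolF; last first.
  move=> fo; near l => t.
  have h1 : p.[t] / q.[t] > 0 by near: t; exact: (proj1 (cvgryPgt _) fo 0).
  have h2 : p.[t] / q.[t] < 0 by near: t; exact: (proj1 (cvgrNyPlt _) fy 0).
  by have := lt_trans h1 h2; rewrite ltxx.
by rewrite asboolT // mulN1r.
Unshelve. all: by end_near. Qed.

End OneSided.
End Germs.

(** * Sums of jumps and the two index formulas *)

Section Totals.
Variable R : realType.
Implicit Types (p q r g : {poly R}) (x a b : R) (l : set_system R)
  (h : R -> set_system R -> R).

(** The shape of the Cauchy index for any function of a point and a side. Identities between indices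
    can then be checked one germ at a time, by [eq_total]. *)
Definition total h a b : R :=
  h a (a^'+)%classic
  + (\sum_(x \in `]a, b[) (h x (x^'+)%classic - h x (x^'-)%classic))%classic
  - h b (b^'-)%classic.

(** Makes the sum in [total] finitely supported: a sum of infinite support is 0 by convention, which
    would break linearity. *)
Definition finite_jumps h :=
  exists s : seq R, forall x, x \notin s ->
    h x (x^'+)%classic = h x (x^'-)%classic.

Lemma total_seqE h (s : seq R) a b : uniq s ->
  (forall x, x \notin s -> h x (x^'+)%classic = h x (x^'-)%classic) ->
  total h a b = h a (a^'+)%classic
  + \sum_(x <- s | a < x < b) (h x (x^'+)%classic - h x (x^'-)%classic)
  - h b (b^'-)%classic.
Proof.
move=> us hs; rewrite /total; congr (_ + _ - _).
rewrite -(@bigfs _ _ _ _ s)//.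
by move=> x _ /hs ->; rewrite subrr.
Qed.

Lemma finite_jumpsP h : finite_jumps h ->
  exists2 s : seq R, uniq s & forall x, x \notin s ->
    h x (x^'+)%classic = h x (x^'-)%classic.
Proof.
by move=> [s hs]; exists (undup s) => [|x]; rewrite ?undup_uniq // mem_undup; apply: hs.
Qed.

Lemma eq_total h1 h2 a b : (forall x l, one_sided x l -> h1 x l = h2 x l) ->
  total h1 a b = total h2 a b.
Proof.
move=> h12; rewrite /total !h12; try exact: one_sided_right; try exact: one_sided_left.
congr (_ + _ - _); apply: eq_fsbigr => x _.
by rewrite !h12; try exact: one_sided_right; try exact: one_sided_left.
Qed.

Lemma finite_jumpsD h1 h2 : finite_jumps h1 -> finite_jumps h2 ->
  finite_jumps (fun x l => h1 x l + h2 x l).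
Proof.
move=> [s1 hs1] [s2 hs2]; exists (s1 ++ s2) => x.
by rewrite mem_cat negb_or => /andP[/hs1 -> /hs2 ->].
Qed.

Lemma finite_jumpsM c h : finite_jumps h -> finite_jumps (fun x l => c * h x l).
Proof. by move=> [s hs]; exists s => x /hs ->. Qed.

Lemma totalD h1 h2 a b : finite_jumps h1 -> finite_jumps h2 ->
  total (fun x l => h1 x l + h2 x l) a b = total h1 a b + total h2 a b.
Proof.
move=> /finite_jumpsP[s1 _ hs1] /finite_jumpsP[s2 _ hs2].
have us := undup_uniq (s1 ++ s2).
rewrite !(total_seqE _ _ us) => [||x|x]; last first.
- by rewrite mem_undup mem_cat negb_or => /andP[/hs1 -> /hs2 ->].
- by rewrite mem_undup mem_cat negb_or => /andP[/hs1 ->].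
- by move=> x; rewrite mem_undup mem_cat negb_or => /andP[_ /hs2 ->].
under eq_bigr do rewrite opprD addrACA.
by rewrite big_split /=; ring.
Qed.

Lemma totalM c h a b : finite_jumps h ->
  total (fun x l => c * h x l) a b = c * total h a b.
Proof.
move=> /finite_jumpsP[s us hs].
rewrite !(total_seqE _ _ us) // => [|x /hs -> //].
under eq_bigr do rewrite -mulrBr.
by rewrite -mulr_sumr; ring.
Qed.

Lemma total_point (h : R -> R) a b : total (fun x _ => h x) a b = h a - h b.
Proof. by rewrite /total fsbig1 ?addr0 // => x _; rewrite subrr. Qed.

Lemma finite_jumps_point (h : R -> R) : finite_jumps (fun x _ => h x).
Proof. by exists [::]. Qed.

(** The jump at [c] supplies the two end terms of the shorter intervals. *)
Lemma total_split h a c b : finite_jumps h -> a < c < b ->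
  total h a b = total h a c + total h c b.
Proof.
move=> /finite_jumpsP[s _ hs] /andP[ac cb].
(* With [c] in the list, its jump can be split off even if it is zero. *)
have us := undup_uniq (c :: s).
rewrite !(total_seqE _ _ us) => [|x|x|x]; try by
  rewrite mem_undup inE negb_or => /andP[_ /hs ->].
have cs : c \in undup (c :: s) by rewrite mem_undup mem_head.
rewrite [in LHS]big_mkcond (bigD1_seq c) //= ac cb -big_mkcondr /=.
pose d x := h x (x^'+)%classic - h x (x^'-)%classic.
rewrite (bigID (fun x => x < c)) /=.
have -> : \sum_(x <- undup (c :: s) | ((x != c) && (a < x < b)) && (x < c)) d x
        = \sum_(x <- undup (c :: s) | a < x < c) d x.
  apply: eq_bigl => x; case: (ltgtP x c) => [xc|xc|->]; rewrite ?andbF ?andbT //.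
  by rewrite (lt_trans xc cb) andbT.
have -> : \sum_(x <- undup (c :: s) | ((x != c) && (a < x < b)) && ~~ (x < c)) d x
        = \sum_(x <- undup (c :: s) | c < x < b) d x.
  apply: eq_bigl => x; case: (ltgtP x c) => [xc|xc|->]; rewrite ?andbF ?andbT ?ltxx //.
  by rewrite (lt_trans ac xc).
rewrite /d; ring.
Qed.

Lemma finite_jumps_sg_along g : finite_jumps (fun _ l => sg_along g l).
Proof.
have [->|g0] := eqVneq g 0.
  exists [::] => x _; rewrite (sg_along0 (one_sided_right x)).
  by rewrite (sg_along0 (one_sided_left x)).
exists (rootsR g) => x xr.
have gx : g.[x] != 0.
  by move: xr; rewrite -roots_on_rootsR.
by rewrite (sg_along_nonroot (one_sided_right x) gx) (sg_along_nonroot (one_sided_left x) gx).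
Qed.

(** Cut at the roots of [g]: on each piece the sign is constant, so the germs at its two ends agree
    and cancel. *)
Lemma total_sg_along g a b : a < b -> total (fun _ l => sg_along g l) a b = 0.
Proof.
have fj := finite_jumps_sg_along g.
have [g0|g0] := eqVneq g 0.
  rewrite (@eq_total _ (fun _ _ => 0)); last by move=> x l lP; rewrite g0 (sg_along0 lP).
  by rewrite (total_point (fun=> 0)) subrr.
(* Induction on a list containing the roots between [a] and [b]: an entry inside the interval cuts
   it in two, an entry outside is dropped. *)
suff H (s : seq R) : forall a b, a < b ->
    (forall x, a < x < b -> root g x -> x \in s) ->
    total (fun _ l => sg_along g l) a b = 0.
  by move=> ab; apply: (H (rootsR g)) => // x _; rewrite -roots_on_rootsR.
elim: s => [|c s IH] {}a {}b ab hs; last first.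
  have [/andP[ac cb]|nacb] := boolP (a < c < b).
    rewrite (@total_split _ _ c) ?ac //; rewrite !IH ?addr0 //.
      move=> x /andP[cx xb] gx; have := hs x; rewrite xb (lt_trans ac cx) => /(_ isT gx).
      by rewrite inE (gt_eqF cx).
    move=> x /andP[ax xc] gx; have := hs x; rewrite ax (lt_trans xc cb) => /(_ isT gx).
    by rewrite inE (lt_eqF xc).
  apply: IH => // x axb gx; have := hs x axb gx; rewrite inE => /orP[/eqP xc|//].
  by move: nacb; rewrite -xc axb.
(* No root is left: the sign at the midpoint is the sign on the whole open interval, hence that of
   both end germs. *)
have noroot x : a < x < b -> g.[x] != 0.
  by move=> axb; apply/negP => /(hs x axb).
pose m := (a + b) / 2.
have mab : a < m < b by rewrite !midf_lt.
have sgm x : a < x < b -> Num.sg g.[x] = Num.sg g.[m].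
  move=> axb; apply: (@polyrN0_itv _ `]a, b[); rewrite ?in_itv //.
have ga : sg_along g (a^'+)%classic = Num.sg g.[m].
  apply: (sg_along_unique (one_sided_right a)); near=> y; apply: sgm.
  apply/andP; split; near: y; [exact: nbhs_right_gt|exact: nbhs_right_lt].
have gb : sg_along g (b^'-)%classic = Num.sg g.[m].
  apply: (sg_along_unique (one_sided_left b)); near=> y; apply: sgm.
  apply/andP; split; near: y; [exact: nbhs_left_gt|exact: nbhs_left_lt].
rewrite /total ga gb fsbig1 ?addr0 ?subrr // => x axb.
have gx := noroot x axb.
by rewrite (sg_along_nonroot (one_sided_right x) gx)
   (sg_along_nonroot (one_sided_left x) gx) subrr.
Unshelve. all: by end_near. Qed.

Definition no_common_root p q := forall x, ~~ (root p x && root q x).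

Definition idx p q : R -> set_system R -> R :=
  fun x l => (q.[x] == 0)%:R * sg_along (p * q) l / 2.

Lemma cauchy_index_total p q a b : no_common_root p q ->
  cauchy_index p q a b = total (idx p q) a b.
Proof.
move=> pq; apply: (@eq_total (fun _ l => ind_along _ l)) => x l lP.
by rewrite (ind_alongE lP).
Qed.

Lemma finite_jumps_idx p q : finite_jumps (idx p q).
Proof.
have [s hs] := finite_jumps_sg_along (p * q).
by exists s => x xs; rewrite /idx hs.
Qed.

(** Turns a difference of boundary values into a [total], so that it can enter a local comparison:
    the germs add up to 0 and the values at the points telescope. *)
Lemma total_sg_jumps g a b : a < b ->
  total (fun x l => sg_along g l - Num.sg g.[x]) a b = Num.sg g.[b] - Num.sg g.[a].
Proof.
move=> ab; rewrite (@eq_total _ (fun x l => sg_along g l + (-1) * Num.sg g.[x])); last first.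
  by move=> x l _; rewrite mulN1r.
rewrite totalD; [|exact: finite_jumps_sg_along|exact: finite_jumps_point].
by rewrite total_sg_along // (total_point (fun x => -1 * _)); ring.
Qed.

Lemma finite_jumps_sg_jumps g : finite_jumps (fun x l => sg_along g l - Num.sg g.[x]).
Proof. by have [s hs] := finite_jumps_sg_along g; exists s => x /hs ->. Qed.

(** Local comparison at [x]: if exactly one of [p], [q] vanishes, its index is half the germ sign of
    [p * q], whose value at [x] is 0; if neither vanishes, both sides are 0. *)
Lemma cauchy_index_inversion p q a b : a < b -> no_common_root p q ->
  cauchy_index p q a b + cauchy_index q p a b =
  (Num.sg (p.[b] * q.[b]) - Num.sg (p.[a] * q.[a])) / 2.
Proof.
move=> ab pq; rewrite !cauchy_index_total //; last by move=> x; rewrite andbC.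
rewrite -totalD; try exact: finite_jumps_idx.
rewrite -!hornerM -total_sg_jumps // [RHS]mulrC -totalM; last exact: finite_jumps_sg_jumps.
apply: eq_total => x l lP; rewrite /idx (mulrC q p) hornerM.
have := pq x; rewrite /root.
have [px|px] := eqVneq p.[x] 0; have [qx|qx] := eqVneq q.[x] 0 => // _.
- by rewrite px (mul0r q.[x]) sgr0 /=; ring.
- by rewrite qx (mulr0 p.[x]) sgr0 /=; ring.
by rewrite (sg_along_nonroot lP) ?hornerM ?mulf_neq0 //=; ring.
Qed.

Lemma total0 a b : total (fun _ _ => 0) a b = 0.
Proof. by rewrite (total_point (fun=> 0)) subrr. Qed.

Lemma cauchy_indexNl p q a b : no_common_root p q ->
  cauchy_index (- p) q a b = - cauchy_index p q a b.
Proof.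
move=> pq; rewrite !cauchy_index_total //; last by move=> x; rewrite rootN.
rewrite -[RHS]mulN1r -totalM; last exact: finite_jumps_idx.
by apply: eq_total => x l lP; rewrite /idx mulNr (sg_alongN lP); ring.
Qed.

(** Only zeros of [q] count, and there the two numerators have the same nonzero value. *)
Lemma cauchy_index_addl_mul p q r a b : no_common_root p q ->
  cauchy_index (r * q + p) q a b = cauchy_index p q a b.
Proof.
move=> pq.
have pq' : no_common_root (r * q + p) q.
  move=> x; apply/negP => /andP[rx qx]; move: (pq x); rewrite qx andbT.
  by move: rx qx; rewrite /root hornerD hornerM => + /eqP qx; rewrite qx mulr0 add0r => ->.
rewrite !cauchy_index_total //; apply: eq_total => x l lP; rewrite /idx.
have [qx|//] := eqVneq q.[x] 0; last by rewrite !mul0r.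
have px : p.[x] != 0 by have := pq x; rewrite /root qx eqxx andbT.
have rx : (r * q + p).[x] = p.[x] by rewrite hornerD hornerM qx mulr0 add0r.
rewrite !(sg_alongM lP) (@sg_along_nonroot _ _ _ lP (r * q + p)) ?rx //.
by rewrite (@sg_along_nonroot _ _ _ lP p).
Qed.

(** The sign identity behind the product formula at a common zero of both imaginary parts. *)
Lemma sgr_add (x y : R) :
  Num.sg (x + y) = Num.sg x + Num.sg y - Num.sg x * Num.sg y * Num.sg (x + y).
Proof.
case: (sgrP x) => hx; case: (sgrP y) => hy; rewrite ?hx ?hy ?addr0 ?add0r ?sgr0; try ring.
- by rewrite (gtr0_sg hy); ring.
- by rewrite (ltr0_sg hy); ring.
- by rewrite (gtr0_sg hx); ring.
- by rewrite (gtr0_sg (addr_gt0 hx hy)); ring.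
- by rewrite (ltr0_sg hx); ring.
- by rewrite (ltr0_sg (_ : x + y < 0)) ?ltr_nDl //; ring.
Qed.

(* Here [Q] is the imaginary part of [(p + i q) (r + i s)].  The term [delta]
   depends only on the real lines spanned by the two factors, which is what
   allows cancelling common factors in [edge_indexM]. *)
Lemma cauchy_index_mul p q r (s : {poly R}) a b : a < b ->
  no_common_root p q -> no_common_root r s ->
  let Q := p * s + q * r in
  let delta x := Num.sg (q.[x] * s.[x] * Q.[x]) / 2 in
  cauchy_index (p * r - q * s) Q a b =
  cauchy_index p q a b + cauchy_index r s a b - (delta b - delta a).
Proof.
move=> ab pq rs Q delta; set P := p * r - q * s.
have PQ : no_common_root P Q.
  move=> x; apply/negP => /andP[/rootP Px /rootP Qx].
  (* Multiplicativity of the squared modulus: a common zero of [P] and [Q] is a common zero of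
     [p, q] or of [r, s]. *)
  have H1 : (p.[x] ^+ 2 + q.[x] ^+ 2) * (r.[x] ^+ 2 + s.[x] ^+ 2) = 0.
    transitivity (P.[x] ^+ 2 + Q.[x] ^+ 2); last by rewrite Px Qx !expr0n addr0.
    by rewrite /P /Q !(hornerD, hornerN, hornerM); ring.
  move/eqP: H1; rewrite mulf_eq0 => /orP[]; rewrite paddr_eq0 ?sqr_ge0 // !sqrf_eq0.
    by move: (pq x); rewrite /root => /negbTE ->.
  by move: (rs x); rewrite /root => /negbTE ->.
rewrite !cauchy_index_total // -totalD; try exact: finite_jumps_idx.
(* The correction becomes a [total] as well, and the claim a local identity, checked according to
   which of [q] and [s] vanish at [x]. *)
have -> : delta b - delta a =
    2^-1 * total (fun x l => sg_along (q * s * Q) l - Num.sg (q * s * Q).[x]) a b.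
  by rewrite total_sg_jumps // /delta !hornerM; ring.
rewrite -totalM; last exact: finite_jumps_sg_jumps.
rewrite -[X in _ - X]mul1r -mulNr -totalM; last first.
  exact/finite_jumpsM/finite_jumps_sg_jumps.
rewrite -totalD; last 2 first.
- by apply: finite_jumpsD; exact: finite_jumps_idx.
- exact/finite_jumpsM/finite_jumpsM/finite_jumps_sg_jumps.
apply: eq_total => x l lP; rewrite /idx.
have pqx := pq x; have rsx := rs x; rewrite /root in pqx rsx.
have [qx|qx] := eqVneq q.[x] 0; have [sx|sx] := eqVneq s.[x] 0.
- have px : p.[x] != 0 by move: pqx; rewrite qx eqxx andbT.
  have rx : r.[x] != 0 by move: rsx; rewrite sx eqxx andbT.
  have -> : Q.[x] = 0 by rewrite /Q hornerD !hornerM qx sx; ring.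
  have Px : P.[x] = p.[x] * r.[x].
    by rewrite /P hornerD hornerN !hornerM qx sx; ring.
  rewrite eqxx !hornerM qx !mul0r sgr0 !(sg_alongM lP).
  rewrite (@sg_along_nonroot _ _ _ lP P) ?Px ?mulf_neq0 //.
  rewrite (@sg_along_nonroot _ _ _ lP p) // (@sg_along_nonroot _ _ _ lP r) //.
  (* The germ signs are read at one nearby point [y], where [sgr_add] applies to [p q r^2] and
     [r s p^2], whose sum is [p r Q]. *)
  have [y [<- <- <- sp sr]] : exists y, [/\ Num.sg q.[y] = sg_along q l,
      Num.sg s.[y] = sg_along s l, Num.sg Q.[y] = sg_along Q l,
      Num.sg p.[y] = Num.sg p.[x] & Num.sg r.[y] = Num.sg r.[x]].
    have l_proper : ProperFilter l by case: lP.
    have nq := near_sg_along lP q; have ns := near_sg_along lP s.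
    have nQ := near_sg_along lP Q.
    have np := near_sg_nonroot lP px; have nr := near_sg_nonroot lP rx.
    near l => y; exists y; split; by near: y.
  rewrite sgrM -sp -sr.
  have {}px : Num.sg p.[y] * Num.sg p.[y] = 1.
    by rewrite -expr2 sqr_sg -sgr_eq0 sp sgr_eq0 px.
  have {}rx : Num.sg r.[y] * Num.sg r.[y] = 1.
    by rewrite -expr2 sqr_sg -sgr_eq0 sr sgr_eq0 rx.
  have := sgr_add (p.[y] * q.[y] * r.[y] ^+ 2) (r.[y] * s.[y] * p.[y] ^+ 2).
  have -> : p.[y] * q.[y] * r.[y] ^+ 2 + r.[y] * s.[y] * p.[y] ^+ 2
    = p.[y] * r.[y] * Q.[y] by rewrite /Q hornerD !hornerM; ring.
  rewrite !sgrM !px !rx !mulr1 => E.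
  have {}E : Num.sg p.[y] * Num.sg r.[y] * Num.sg Q.[y] = Num.sg p.[y] * Num.sg q.[y]
      + Num.sg r.[y] * Num.sg s.[y] - Num.sg q.[y] * Num.sg s.[y] * Num.sg Q.[y].
    rewrite {1}E; congr (_ + _ - _).
    rewrite -[RHS]mul1r -[in RHS]px -[RHS]mul1r -[in RHS]rx; ring.
  rewrite !mul1r E /=; ring.
(* Here [Q(x) = p(x) s(x)] is nonzero, so the germ of [q s Q] has the sign of [p q]: the correction
   cancels the index of [p / q]. The next case is symmetric. *)
- have px : p.[x] != 0 by move: pqx; rewrite qx eqxx andbT.
  have Qx : Q.[x] = p.[x] * s.[x] by rewrite /Q hornerD !hornerM qx; ring.
  rewrite Qx (negbTE (mulf_neq0 px sx)) !hornerM qx !(sg_alongM lP).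
  rewrite !(@sg_along_nonroot _ _ _ lP s) // ?(@sg_along_nonroot _ _ _ lP Q);
    last by rewrite Qx mulf_neq0.
  rewrite ?(@sg_along_nonroot _ _ _ lP p) // ?Qx.
  rewrite !mul0r sgr0 sgrM.
  have : Num.sg s.[x] ^+ 2 = 1 by rewrite sqr_sg sx.
  move=> ss; have E : Num.sg s.[x] * (Num.sg p.[x] * Num.sg s.[x]) = Num.sg p.[x].
    by rewrite mulrCA -expr2 ss mulr1.
  rewrite -(mulrA (sg_along q l)) E. rewrite /=; ring.
- have rx : r.[x] != 0 by move: rsx; rewrite sx eqxx andbT.
  have Qx : Q.[x] = q.[x] * r.[x] by rewrite /Q hornerD !hornerM sx; ring.
  rewrite Qx (negbTE (mulf_neq0 qx rx)) !hornerM sx !(sg_alongM lP).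
  rewrite !(@sg_along_nonroot _ _ _ lP q) // ?(@sg_along_nonroot _ _ _ lP Q);
    last by rewrite Qx mulf_neq0.
  rewrite ?(@sg_along_nonroot _ _ _ lP r) // ?Qx.
  rewrite !(mul0r, mulr0) sgr0 sgrM.
  have : Num.sg q.[x] ^+ 2 = 1 by rewrite sqr_sg qx.
  move=> ss; have E : Num.sg q.[x] * (Num.sg q.[x] * Num.sg r.[x]) = Num.sg r.[x].
    by rewrite mulrA -expr2 ss mul1r.
  by rewrite (mulrAC _ (sg_along s l)) E /=; ring.
rewrite !mul0r addr0 add0r.
have [Qx|Qx] := eqVneq Q.[x] 0; last first.
  by rewrite (@sg_along_nonroot _ _ _ lP (q * s * Q)) ?hornerM ?mulf_neq0 // subrr /=; ring.
rewrite !(sg_alongM lP) !hornerM Qx mulr0 sgr0.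
rewrite !(@sg_along_nonroot _ _ _ lP q) ?(@sg_along_nonroot _ _ _ lP s) //.
(* A zero of [Q] alone gives [q r = - p s] at [x], hence [P q s < 0]: the index of [P / Q] is then
   exactly minus the correction. *)
have PE : P.[x] * (q.[x] * s.[x]) = - ((p.[x] * s.[x]) ^+ 2 + (q.[x] * s.[x]) ^+ 2).
  have qr : q.[x] * r.[x] = - (p.[x] * s.[x]).
    by apply/eqP; rewrite -addr_eq0 addrC -!hornerM -hornerD Qx.
  rewrite /P hornerD hornerN !hornerM.
  rewrite (_ : _ * _ = p.[x] * s.[x] * (q.[x] * r.[x]) - (q.[x] * s.[x]) ^+ 2); last by ring.
  by rewrite qr; ring.
have Pqs : P.[x] * (q.[x] * s.[x]) < 0.
  by rewrite PE oppr_lt0 ltr_wpDl ?sqr_ge0 // exprn_even_gt0 // mulf_neq0.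
have Px : P.[x] != 0 by apply: contraTneq Pqs => ->; rewrite mul0r ltxx.
rewrite (@sg_along_nonroot _ _ _ lP P) //.
have := ltr0_sg Pqs; rewrite !sgrM => E.
have qs : (Num.sg q.[x] * Num.sg s.[x]) ^+ 2 = 1 by rewrite -sgrM sqr_sg mulf_neq0.
have -> : Num.sg P.[x] = - (Num.sg q.[x] * Num.sg s.[x]).
  by rewrite -[LHS]mulr1 -[in LHS]qs expr2 mulrA E mulN1r.
rewrite /=; ring.
Unshelve. all: by end_near. Qed.

End Totals.

(** * Sturm chains *)

Section Sturm.
Variable R : realType.
Implicit Types (p q r g U V : {poly R}) (x a b : R) (l : set_system R).

Lemma ind_along_near (f g : R -> R) l : Filter l ->
  (\forall y \near l, f y = g y) -> ind_along f l = ind_along g l.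
Proof.
move=> l_filter fg.
have gf : \forall y \near l, g y = f y by near=> y; apply/esym; near: y.
have fgl (F : set_system R) : (f @ l --> F)%classic = (g @ l --> F)%classic.
  by apply/propext; split=> h; [apply: cvg_trans h; exact: near_eq_cvg|
    apply: cvg_trans h; exact: near_eq_cvg].
by rewrite /ind_along !fgl.
Unshelve. all: by end_near. Qed.

(** The fractions can differ only at zeros of [d], and none of these lies in a small punctured
    neighbourhood. *)
Lemma cauchy_index_cancel (d p q : {poly R}) a b : d != 0 ->
  cauchy_index (d * p) (d * q) a b = cauchy_index p q a b.
Proof.
move=> d0; apply: (@eq_total R (fun _ l => ind_along _ l) (fun _ l => ind_along _ l)).
move=> x l lP; have l_proper : ProperFilter l by case: lP.
apply: ind_along_near; have nd := near_nonroot lP d0.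
near=> y; rewrite !hornerM -mulf_div divff ?mul1r //.
by near: y.
Unshelve. all: by end_near. Qed.

Lemma cauchy_index0l V a b : cauchy_index 0 V a b = 0.
Proof.
have -> : cauchy_index 0 V a b = cauchy_index 0 1 a b.
  by rewrite /cauchy_index; under eq_fun do rewrite horner0 mul0r;
    under [in RHS]eq_fun do rewrite horner0 mul0r.
rewrite cauchy_index_total; last by move=> x; rewrite (negbTE (root1 _)) andbF.
rewrite -[RHS](total0 a b); apply: eq_total => x l lP.
by rewrite /idx mul0r (sg_along0 lP) mulr0 mul0r.
Qed.

Lemma cauchy_index_constr U (c : R) a b : cauchy_index U c%:P a b = 0.
Proof.
have [->|c0] := eqVneq c 0.
  rewrite -[RHS](cauchy_index0l 1 a b) /cauchy_index.
  by under eq_fun do rewrite hornerC invr0 mulr0;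
    under [in RHS]eq_fun do rewrite horner0 mul0r.
rewrite cauchy_index_total; last by move=> x; rewrite rootC (negbTE c0) andbF.
rewrite -[RHS](total0 a b); apply: eq_total => x l lP.
by rewrite /idx hornerC (negbTE c0) !mul0r.
Qed.

Lemma sign_changes_cons2 (x y : R) (s : seq R) :
  sign_changes [:: x, y & s] = `|Num.sg x - Num.sg y| / 2 + sign_changes (y :: s).
Proof. by rewrite /sign_changes /= big_ord_recl. Qed.

(** Puts a sign variation in the form of the boundary term of the inversion formula. *)
Lemma normr_sgB (x y : R) : ~~ ((x == 0) && (y == 0)) ->
  `|Num.sg x - Num.sg y| = 1 - Num.sg (x * y).
Proof.
rewrite sgrM; case: sgrP => hx; case: sgrP => hy; rewrite ?hx ?hy ?eqxx // => _.
- by rewrite sub0r normrN normr1; ring.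
- by rewrite sub0r opprK normr1; ring.
- by rewrite subr0 normr1; ring.
- by rewrite subrr normr0; ring.
- by rewrite opprK ger0_norm //; ring.
- by rewrite subr0 normrN normr1; ring.
- by rewrite ler0_norm; [ring|rewrite -opprD oppr_le0].
- by rewrite opprK addNr normr0; ring.
Qed.

Lemma sturm_recE m p q : exists s, sturm_rec m.+1 p q = p :: s.
Proof. by rewrite /=; case: eqP; [exists [::]|eexists]. Qed.

(** Induction along the Euclidean algorithm. The pair [p, q] contributes Ind(p/q) + Ind(q/p) by
    inversion; the rest of the chain contributes the index of [- (p %% q)] over [q], which is
    -Ind(p/q). *)
Lemma sturm_rec_index fuel p q a b : a < b -> no_common_root p q ->
  (size q < fuel)%N ->
  sign_changes [seq g.[a] | g <- sturm_rec fuel p q]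
  - sign_changes [seq g.[b] | g <- sturm_rec fuel p q] = cauchy_index q p a b.
Proof.
move=> ab; elim: fuel p q => [//|m IH] p q pq sq.
rewrite [sturm_rec _ _ _]/=; have [q0|q0] := eqVneq q 0.
  by rewrite q0 cauchy_index0l /sign_changes /= !big_ord0 subrr.
have qp : no_common_root q p by move=> x; rewrite andbC.
have pqr x : root q x -> root (p %% q) x = root p x.
  by move=> /rootP qx; rewrite /root [in RHS](divp_eq p q) hornerD hornerM qx mulr0 add0r.
have qr : no_common_root q (p %% q).
  by move=> x; apply/negP => /andP[qx]; rewrite pqr // => px; have := pq x; rewrite px qx.
have qr' : no_common_root q (- (p %% q)) by move=> x; rewrite rootN.
have sr : (size (- (p %% q)) < m)%N.
  by rewrite size_polyN (leq_trans _ (_ : size q <= m)%N) ?ltn_modp.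
have H := IH _ _ qr' sr.
(* Fuel remains, so the tail of the chain does start with [q]. *)
case: m => [//|m] in sq sr IH H *.
have [s sE] := sturm_recE m q (- (p %% q)).
rewrite sE in H *; rewrite /= in H.
rewrite [map _ _]/= [in X in _ - X]/= !sign_changes_cons2.
rewrite opprD addrACA H.
have nab x : ~~ ((p.[x] == 0) && (q.[x] == 0)) by exact: pq.
rewrite !normr_sgB //.
have := cauchy_index_inversion ab qp.
rewrite [in cauchy_index p q a b](divp_eq p q) cauchy_index_addl_mul; last first.
  by move=> x; rewrite andbC.
rewrite cauchy_indexNl; last by move=> x; rewrite andbC.
by rewrite ![q.[_] * p.[_]]mulrC; lra.
Qed.

(** The chain is that of the reduced fraction, which has the same index by cancellation of the
    gcd. *)
Lemma sturm_index_cauchy U V a b : a < b -> sturm_index U V a b = cauchy_index U V a b.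
Proof.
move=> ab; rewrite /sturm_index /sturm_chain.
have [d0|d0] := eqVneq (gcdp U V) 0.
  have /andP[/eqP-> /eqP->] : (U == 0) && (V == 0) by rewrite -gcdp_eq0 d0.
  by rewrite cauchy_index0l !div0p size_poly0 /= eqxx /sign_changes /= !big_ord0 subrr.
rewrite sturm_rec_index //; last first.
  have : coprimep (U %/ gcdp U V) (V %/ gcdp U V).
    by apply: coprimep_div_gcd; move: d0; rewrite gcdp_eq0 negb_and.
  move=> cUV x; apply/negP => /andP[vx ux].
  by have := coprimep_root cUV ux; rewrite -/(root _ _) vx.
rewrite -(cauchy_index_cancel _ _ _ _ d0) ![gcdp U V * _]mulrC.
by rewrite !divpK ?dvdp_gcdl ?dvdp_gcdr.
Qed.

End Sturm.

(** * Winding numbers along rectangles *)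

Section Winding.
Variable R : realType.
Implicit Types (P Q F H : {poly R[i]}) (G : rect R) (u v z : R[i]).

Local Notation Re := complex.Re.
Local Notation Im := complex.Im.

(** * Real and imaginary parts of complex polynomials *)

Lemma ReM u v : Re (u * v) = Re u * Re v - Im u * Im v.
Proof. by case: u; case: v. Qed.

Lemma ImM u v : Im (u * v) = Re u * Im v + Im u * Re v.
Proof. by case: u => a b; case: v => c d /=; rewrite [b * c]mulrC. Qed.

Lemma ReD u v : Re (u + v) = Re u + Re v. Proof. by case: u; case: v. Qed.
Lemma ImD u v : Im (u + v) = Im u + Im v. Proof. by case: u; case: v. Qed.

Lemma coef_re_poly P k : (re_poly P)`_k = Re P`_k.
Proof. by rewrite coef_poly; case: ltnP => // /(nth_default 0) ->. Qed.

Lemma coef_im_poly P k : (im_poly P)`_k = Im P`_k.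
Proof. by rewrite coef_poly; case: ltnP => // /(nth_default 0) ->. Qed.

Lemma Re_sum n (f : 'I_n -> R[i]) : Re (\sum_i f i) = \sum_i Re (f i).
Proof. by rewrite (big_morph (@complex.Re R) ReD (erefl _ : Re 0 = 0)). Qed.

Lemma Im_sum n (f : 'I_n -> R[i]) : Im (\sum_i f i) = \sum_i Im (f i).
Proof. by rewrite (big_morph (@complex.Im R) ImD (erefl _ : Im 0 = 0)). Qed.

Lemma re_polyM P Q :
  re_poly (P * Q) = re_poly P * re_poly Q - im_poly P * im_poly Q.
Proof.
apply/polyP => k; rewrite coefB !coefM coef_re_poly coefM Re_sum -sumrB.
by apply: eq_bigr => i _; rewrite ReM !coef_re_poly !coef_im_poly.
Qed.

Lemma im_polyM P Q :
  im_poly (P * Q) = re_poly P * im_poly Q + im_poly P * re_poly Q.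
Proof.
apply/polyP => k; rewrite coefD !coefM coef_im_poly coefM Im_sum -big_split /=.
by apply: eq_bigr => i _; rewrite ImM !coef_re_poly !coef_im_poly.
Qed.

Lemma im_polyC u : im_poly u%:P = (Im u)%:P.
Proof. by apply/polyP => k; rewrite coef_im_poly !coefC; case: eqP. Qed.

Lemma re_poly_linear u v : re_poly (u%:P + v *: 'X) = (Re u)%:P + Re v *: 'X.
Proof.
apply/polyP => k; rewrite coef_re_poly !coefD !coefZ !coefC !coefX ReD.
by case: (k == 0%N); case: (k == 1%N); rewrite ?mulr1 ?mulr0.
Qed.

Lemma im_poly_linear u v : im_poly (u%:P + v *: 'X) = (Im u)%:P + Im v *: 'X.
Proof.
apply/polyP => k; rewrite coef_im_poly !coefD !coefZ !coefC !coefX ImD.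
by case: (k == 0%N); case: (k == 1%N); rewrite ?mulr1 ?mulr0.
Qed.

Lemma re_imP P : P = map_poly (real_complex R) (re_poly P)
  + 'i%C *: map_poly (real_complex R) (im_poly P).
Proof.
apply/polyP => k; rewrite coefD coefZ !coef_map.
by rewrite -complexE.
Qed.

Lemma horner_re_im P (t : R) :
  P.[t%:C] = (re_poly P).[t] +i* (im_poly P).[t].
Proof.
by rewrite {1}[P]re_imP hornerD hornerZ !horner_map /= [RHS]complexE.
Qed.

Definition edge_index P : R := cauchy_index (re_poly P) (im_poly P) 0 1.

(** The boundary correction of the product formula. It depends only on the values of the two factors
    at the endpoint. *)
Definition mul_defect u v : R := Num.sg (Im u * Im v * Im (u * v)) / 2.

Lemma complex_neq0 (a b : R) : a +i* b != 0 -> ~~ ((a == 0) && (b == 0)).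
Proof. by rewrite eq_complex. Qed.

Lemma coprime_no_common_root (p q : {poly R}) : (p != 0) || (q != 0) ->
  no_common_root (p %/ gcdp p q) (q %/ gcdp p q).
Proof.
move=> pq0 x; apply/negP => /andP[px qx].
have := coprimep_root (coprimep_div_gcd pq0) px; by rewrite -/(root _ _) qx.
Qed.

(** Divide each factor by the gcd of its real and imaginary parts, then apply [cauchy_index_mul].
    The gcds do not vanish at the endpoints. *)
Lemma edge_indexM P Q :
  P.[0] != 0 -> P.[1] != 0 -> Q.[0] != 0 -> Q.[1] != 0 ->
  edge_index (P * Q) = edge_index P + edge_index Q
    - (mul_defect P.[1] Q.[1] - mul_defect P.[0] Q.[0]).
Proof.
rewrite -(rmorph0 (real_complex R)) -(rmorph1 (real_complex R)) !horner_re_im.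
rewrite /edge_index re_polyM im_polyM.
move: (re_poly P) (im_poly P) (re_poly Q) (im_poly Q) => p q r s.
move=> /complex_neq0 P0 /complex_neq0 P1 /complex_neq0 Q0 /complex_neq0 Q1.
have pq0 : (p != 0) || (q != 0).
  by rewrite -negb_and; apply: contra P0 => /andP[/eqP-> /eqP->]; rewrite horner0 eqxx.
have rs0 : (r != 0) || (s != 0).
  by rewrite -negb_and; apply: contra Q0 => /andP[/eqP-> /eqP->]; rewrite horner0 eqxx.
have := coprime_no_common_root pq0; have := coprime_no_common_root rs0.
have d0 : gcdp p q != 0 by rewrite gcdp_eq0 negb_and.
have e0 : gcdp r s != 0 by rewrite gcdp_eq0 negb_and.
have := divpK (dvdp_gcdl p q); have := divpK (dvdp_gcdr p q).
have := divpK (dvdp_gcdl r s); have := divpK (dvdp_gcdr r s).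
move: (gcdp p q) (gcdp r s) d0 e0 => d e d0 e0.
move: (p %/ d) (q %/ d) (r %/ e) (s %/ e) => p' q' r' s'.
move=> sE rE qE pE rs pq.
have dx x : ~~ ((p.[x] == 0) && (q.[x] == 0)) -> d.[x] != 0.
  by apply: contra => /eqP dx; rewrite -pE -qE !hornerM dx !mulr0 eqxx.
have ex x : ~~ ((r.[x] == 0) && (s.[x] == 0)) -> e.[x] != 0.
  by apply: contra => /eqP ex; rewrite -rE -sE !hornerM ex !mulr0 eqxx.
have -> : p * r - q * s = (d * e) * (p' * r' - q' * s') by rewrite -pE -qE -rE -sE; ring.
have -> : p * s + q * r = (d * e) * (p' * s' + q' * r') by rewrite -pE -qE -rE -sE; ring.
have -> : cauchy_index p q 0 1 = cauchy_index p' q' 0 1.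
  by rewrite -pE -qE ![_ * d]mulrC cauchy_index_cancel.
have -> : cauchy_index r s 0 1 = cauchy_index r' s' 0 1.
  by rewrite -rE -sE ![_ * e]mulrC cauchy_index_cancel.
rewrite cauchy_index_cancel ?mulf_neq0 // cauchy_index_mul //.
(* Restoring the gcds multiplies the argument of the sign by the positive square of [d(x) e(x)]. *)
have defect x : d.[x] != 0 -> e.[x] != 0 ->
    mul_defect (p.[x] +i* q.[x]) (r.[x] +i* s.[x]) =
    Num.sg (q'.[x] * s'.[x] * (p' * s' + q' * r').[x]) / 2.
  move=> dx0 ex0; rewrite /mul_defect ImM /= -pE -qE -rE -sE !(hornerD, hornerM).
  congr (_ / 2).
  set X := q'.[x] * s'.[x] * _.
  rewrite (_ : _ * _ = (d.[x] * e.[x]) ^+ 2 * X); last by rewrite /X; ring.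
  by rewrite sgrM [Num.sg (_ ^+ 2)]gtr0_sg ?mul1r // exprn_even_gt0 // mulf_neq0.
by rewrite !defect ?dx ?ex.
Qed.

Lemma windingE F G : winding F G =
  (\sum_(e <- edges G) edge_index (along F e)) / 2.
Proof. by []. Qed.

Lemma winding_sturm F G : winding F G = sturm_winding F G.
Proof.
rewrite /winding /sturm_winding; congr (_ / 2).
by apply: eq_bigr => e _; rewrite sturm_index_cauchy.
Qed.

Lemma along0 F (e : R[i] * R[i]) : (along F e).[0] = F.[e.1].
Proof. by rewrite /along horner_comp hornerD hornerC hornerZ hornerX mulr0 addr0. Qed.

Lemma along1 F (e : R[i] * R[i]) : (along F e).[1] = F.[e.2].
Proof. by rewrite /along horner_comp hornerD hornerC hornerZ hornerX mulr1 addrC subrK. Qed.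

(** Each vertex ends one edge and starts the next, so the defects cancel around the boundary. *)
Lemma windingM F H G : all (fun v => F.[v] != 0) (vertices G) ->
  all (fun v => H.[v] != 0) (vertices G) ->
  winding (F * H) G = winding F G + winding H G.
Proof.
rewrite !windingE /edges /vertices /rot /= => /and5P[F0 F1 F2 F3 _] /and5P[H0 H1 H2 H3 _].
rewrite !(big_cons, big_nil) ![along (F * H) _]comp_polyM -!/(along _ _).
by rewrite !edge_indexM !(along0, along1) //=; lra.
Qed.

Lemma along_linear z (e : R[i] * R[i]) :
  along ('X - z%:P) e = (e.1 - z)%:P + (e.2 - e.1) *: 'X.
Proof. by rewrite /along comp_polyB comp_polyX comp_polyC polyCB; ring. Qed.

(** Inversion: the reciprocal fraction has a constant denominator, hence index 0, and only the
    boundary term remains. *)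
Lemma cauchy_index_constl (c u v : R) :
  cauchy_index c%:P (u%:P + v *: 'X) 0 1 =
  Num.sg c * (Num.sg (u + v) - Num.sg u) / 2.
Proof.
have [->|c0] := eqVneq c 0; first by rewrite cauchy_index0l sgr0 !mul0r.
have nc : no_common_root c%:P (u%:P + v *: 'X).
  by move=> x; rewrite rootC (negbTE c0).
have := cauchy_index_inversion (ltr01 : 0 < 1 :> R) nc.
rewrite cauchy_index_constr addr0 => ->.
by rewrite !(hornerD, hornerC, hornerZ, hornerX) mulr1 mulr0 addr0 !sgrM -mulrBr.
Qed.

(** The imaginary part is constant on horizontal edges, which contribute 0; the real part is
    constant on vertical ones. *)
Lemma winding_linear z G : winding ('X - z%:P) G =
  (Num.sg (xmax G - Re z) - Num.sg (xmin G - Re z))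
  * (Num.sg (ymax G - Im z) - Num.sg (ymin G - Im z)) / 4.
Proof.
case: G z => x0 x1 y0 y1 [x y].
rewrite windingE /edges /vertices /rot /= !(big_cons, big_nil).
rewrite /edge_index !along_linear !re_poly_linear !im_poly_linear /=.
rewrite !subrr !scale0r !addr0 !cauchy_index_constr !cauchy_index_constl.
rewrite (_ : y0 - y + (y1 - y0) = y1 - y); last by ring.
rewrite (_ : y1 - y + (y0 - y1) = y0 - y); last by ring.
lra.
Qed.

(** Each difference of signs is 2 strictly between the bounds, 1 on a bound and 0 outside. The
    product 1, which would give a quarter, occurs only at vertices. *)
Lemma winding_linear_weight z G : is_rect G -> z \notin vertices G ->
  winding ('X - z%:P) G = root_weight G z.
Proof.
rewrite winding_linear; case: G z => x0 x1 y0 y1 [x y].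
rewrite /is_rect /vertices /root_weight /in_interior /in_rect !inE !eq_complex /=.
move=> /andP[x01 y01].
have sgp (a b : R) : a < b -> Num.sg (b - a) = 1 by move=> ab; rewrite gtr0_sg ?subr_gt0.
have sgn (a b : R) : a < b -> Num.sg (a - b) = -1 by move=> ab; rewrite ltr0_sg ?subr_lt0.
have sg0 (a : R) : Num.sg (a - a) = 0 by rewrite subrr sgr0.
have [xL|xL|xL] := ltgtP x x0; have [xR|xR|xR] := ltgtP x x1; try by lra.
all: have [yL|yL|yL] := ltgtP y y0; have [yR|yR|yR] := ltgtP y y1; try by lra.
all: move=> /= zG //; subst.
all: repeat match goal with H : is_true (?a < ?b) |- _ =>
  rewrite ?(sgp a b H) ?(sgn a b H); clear H end.
all: by rewrite ?sg0; lra.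
Qed.

Lemma winding_prod G (s : seq R[i]) : is_rect G ->
  all (fun z => z \notin vertices G) s ->
  winding (\prod_(z <- s) ('X - z%:P)) G = \sum_(z <- s) root_weight G z.
Proof.
move=> rG; elim: s => [_|z s IH /= /andP[zG sG]].
  rewrite !big_nil windingE /edges /= !(big_cons, big_nil).
  rewrite /edge_index /along -polyC1 !comp_polyC !im_polyC.
  by rewrite !cauchy_index_constr !addr0 mul0r.
rewrite !big_cons windingM ?winding_linear_weight ?IH //.
  by apply/allP => v vG; rewrite hornerXsubC subr_eq0; apply: contraNneq zG => <-.
apply/allP => v vG; rewrite horner_prod prodf_seq_neq0; apply/allP => w ws /=.
by rewrite hornerXsubC subr_eq0; apply: contraNneq (allP sG w ws) => <-.
Qed.

End Winding.

(** * Location of the roots *)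

Section Roots.
Variable R : realType.
Implicit Types (F : {poly R[i]}) (G H : rect R) (u v w : R[i]).
Local Notation Re := complex.Re.
Local Notation Im := complex.Im.
Local Notation normc := Normc.normc.

(** * The modulus, the Cauchy bound and the splitting *)

Lemma normc_ge0 w : 0 <= normc w.
Proof. by case: w => a b; exact: sqrtr_ge0. Qed.

Lemma normcX w k : normc (w ^+ k) = normc w ^+ k.
Proof.
by elim: k => [|k IH]; rewrite ?expr0 ?Normc.normc1 // !exprS Normc.normcM IH.
Qed.

Lemma le_normc_sum n (f : 'I_n -> R[i]) :
  normc (\sum_i f i) <= \sum_i normc (f i).
Proof.
elim/big_rec2: _ => [|i y1 y2 _ IH]; first by rewrite Normc.normc0.
by apply: le_trans (le_normcD _ _) _; rewrite lerD2l.
Qed.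

Lemma normc_le_ReIm w : normc w <= `|Re w| + `|Im w|.
Proof.
case: w => a b /=; rewrite -[leRHS]ger0_norm ?addr_ge0 // -sqrtr_sqr.
apply: ler_wsqrtr; rewrite sqrrD !real_normK ?num_real // addrAC lerDl.
by rewrite mulrn_wge0 // mulr_ge0.
Qed.

(** With [M] the largest modulus of a coefficient, a root with [|w| >= 1 + M] would satisfy [|w|^n
    <= M (1 + ... + |w|^(n-1)) <= |w|^n - 1]. *)
Lemma lt_cauchy_radius n (c : 'I_n -> R[i]) w :
  ('X^n + \sum_(i < n) c i *: 'X^(n - i.+1)).[w] = 0 ->
  normc w < cauchy_radius c.
Proof.
rewrite hornerD hornerXn horner_sum => /eqP; rewrite addr_eq0 => /eqP wE.
rewrite /cauchy_radius ltNge; apply/negP.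
set M := \big[_/_]_(_ < _) _ => wM.
have cM i : normc (c i) <= M by rewrite /M; exact: le_bigmax.
have le1 : normc w ^+ n <= \sum_(i < n) M * normc w ^+ i.
  rewrite -normcX wE normcN (le_trans (le_normc_sum _)) //.
  rewrite [leRHS](reindex_inj rev_ord_inj) /=; apply: ler_sum => i _.
  by rewrite hornerZ hornerXn Normc.normcM normcX ler_wpM2r ?exprn_ge0 ?normc_ge0.
have : normc w ^+ n <= normc w ^+ n - 1.
  rewrite subrX1 mulr_sumr (le_trans le1) //; apply: ler_sum => i _.
  by rewrite ler_wpM2r ?exprn_ge0 ?normc_ge0 // lerBrDl.
by rewrite lerBrDl gerDr ler10.
Qed.

Lemma monic_split n (c : 'I_n -> R[i]) : exists z : 'I_n -> R[i],
  'X^n + \sum_(i < n) c i *: 'X^(n - i.+1) = \prod_(i < n) ('X - (z i)%:P).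
Proof.
set F := 'X^n + _.
have sS : (size (\sum_(i < n) c i *: 'X^(n - i.+1))%R <= n)%N.
  apply: leq_trans (size_sum _ _ _) _; apply/bigmax_leqP => i _.
  rewrite (leq_trans (size_scale_leq _ _)) // size_polyXn.
  by rewrite ltn_subrL /= (leq_ltn_trans _ (ltn_ord i)).
have sF : size F = n.+1 by rewrite size_polyDl size_polyXn.
have lF : lead_coef F = 1 by rewrite lead_coefDl ?lead_coefXn // size_polyXn.
have [s sE] := closed_field_poly_normal F.
rewrite lF scale1r in sE.
have ss : size s = n by move: sF; rewrite sE size_prod_XsubC => -[].
exists (fun i => s`_i); rewrite sE (big_nth 0) ss big_mkord //.
Qed.

(** * Closed rectangles and their quarters *)

Lemma in_rect_vertex G v : is_rect G -> v \in vertices G -> in_rect G v.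
Proof.
move=> /andP[/ltW xG /ltW yG]; rewrite /vertices /in_rect !inE.
by move=> /or4P[] /eqP->; rewrite /= !lexx ?xG ?yG.
Qed.

Lemma in_rectP G v : in_rect G v = (0 < root_weight G v).
Proof.
rewrite /root_weight; case: ifP => [|_]; last by case: ifP; rewrite ?ltxx ?invr_gt0 ?ltr0n.
rewrite ltr01 => /andP[/andP[/ltW a /ltW b] /andP[/ltW c /ltW d]].
by rewrite /in_rect a b c d.
Qed.

Lemma root_weight_ge0 G v : 0 <= root_weight G v.
Proof. by rewrite /root_weight; do 2?case: ifP => _ //; rewrite ?invr_ge0 ?ler0n. Qed.

Lemma quartersP G H : is_rect G -> H \in quarters G ->
  [/\ is_rect H, forall w, in_rect H w -> in_rect G w,
     xmax H - xmin H = (xmax G - xmin G) / 2 &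
     ymax H - ymin H = (ymax G - ymin G) / 2].
Proof.
case: G => x0 x1 y0 y1; rewrite /is_rect /quarters !inE /= => /andP[x01 y01].
by move=> /or4P[] /eqP->; rewrite /in_rect /=; split; try (by lra);
  move=> [x y] /= /andP[/andP[? ?] /andP[? ?]]; lra.
Qed.

Lemma quarters_cover G w : in_rect G w -> exists2 H, H \in quarters G & in_rect H w.
Proof.
case: G w => x0 x1 y0 y1 [x y]; rewrite /in_rect /= => /andP[/andP[xl xr] /andP[yl yr]].
have [xm|/ltW xm] := leP x ((x0 + x1) / 2); have [ym|/ltW ym] := leP y ((y0 + y1) / 2).
- exists (Rect x0 ((x0 + x1) / 2) y0 ((y0 + y1) / 2)); rewrite ?inE ?eqxx ?orbT //=.
  by rewrite xl xm yl ym.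
- exists (Rect x0 ((x0 + x1) / 2) ((y0 + y1) / 2) y1); rewrite ?inE ?eqxx ?orbT //=.
  by rewrite xl xm yr ym.
- exists (Rect ((x0 + x1) / 2) x1 y0 ((y0 + y1) / 2)); rewrite ?inE ?eqxx ?orbT //=.
  by rewrite xr xm yl ym.
- exists (Rect ((x0 + x1) / 2) x1 ((y0 + y1) / 2) y1); rewrite ?inE ?eqxx ?orbT //=.
  by rewrite xr xm yr ym.
Qed.

Lemma normc_center G w : is_rect G -> in_rect G w ->
  normc (Defs.center G - w) <= ((xmax G - xmin G) + (ymax G - ymin G)) / 2.
Proof.
move=> rG wG; apply: le_trans (normc_le_ReIm _) _.
case: G w rG wG => x0 x1 y0 y1 [x y]; rewrite /is_rect /in_rect /=.
move=> /andP[x01 y01] /andP[/andP[xl xr] /andP[yl yr]].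
rewrite [leRHS]mulrDl; apply: lerD; rewrite ler_norml; lra.
Qed.

(** * The bisection algorithm on a product of linear factors *)

Section FactoredPolynomial.
Variables (n : nat) (z : 'I_n -> R[i]).
Local Notation F := (\prod_(i < n) ('X - (z i)%:P)).

Lemma root_factored v : reflect (exists i, z i = v) (F.[v] == 0).
Proof.
rewrite horner_prod prodf_seq_eq0.
apply: (iffP hasP) => [[i _ /=]|[i <-]].
  by rewrite hornerXsubC subr_eq0 => /eqP ->; exists i.
by exists i; rewrite ?mem_index_enum //= hornerXsubC subrr.
Qed.

Lemma winding_factored G : is_rect G ->
  (forall v, v \in vertices G -> F.[v] != 0) ->
  winding F G = \sum_(i < n) root_weight G (z i).
Proof.
move=> rG vG.
have := @winding_prod R G (codom z) rG.
rewrite !big_image /=; apply.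
apply/allP => _ /codomP[i ->]; apply/negP => /vG /root_factored[].
by exists i.
Qed.

(** A root at a vertex is caught by the first test. Otherwise the winding number is a sum of
    nonnegative weights, positive as soon as one root lies in the closed rectangle. *)
Lemma contains_root_factored G : is_rect G ->
  contains_root F G <-> exists i, in_rect G (z i).
Proof.
move=> rG; rewrite /contains_root.
have [/hasP[v vG /root_factored[i iv]]|/hasPn noroot] /= := boolP (has _ _).
  by split=> // _; exists i; rewrite iv in_rect_vertex.
rewrite -winding_sturm winding_factored //.
have ge0 (i : 'I_n) : true -> 0 <= root_weight G (z i).
  by move=> _; exact: root_weight_ge0.
split=> [|[i iG]].
  rewrite lt_def psumr_neq0 // => /andP[/hasP[i _ /= iG] _].
  by exists i; rewrite in_rectP.
rewrite lt_def sumr_ge0 // andbT psumr_neq0 //; apply/hasP; exists i.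
  exact: mem_index_enum.
by rewrite /= -in_rectP.
Qed.

(** A root is never lost: some closed quarter contains it, and the exact test keeps that quarter.
    The same test discards every rectangle without roots. *)
Lemma locateP G k : is_rect G -> (forall i, in_rect G (z i)) ->
  (forall i, exists2 H, H \in locate F G k & in_rect H (z i)) /\
  (forall H, H \in locate F G k ->
     [/\ is_rect H,
         forall w, in_rect H w -> in_rect G w,
         xmax H - xmin H = (xmax G - xmin G) / 2 ^+ k,
         ymax H - ymin H = (ymax G - ymin G) / 2 ^+ k
       & exists i, in_rect H (z i)]).
Proof.
move=> rG zG; elim: k => [|k [IH1 IH2]].
  rewrite [locate F G 0]/(keep F [:: G]) /keep; split=> [i|H].
    exists G => //; rewrite mem_filter mem_head andbT.
    by apply/(contains_root_factored rG); exists i.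
  rewrite mem_filter inE => /andP[cH /eqP HG]; rewrite HG in cH *.
  by split; rewrite ?expr0 ?divr1 //; apply/(contains_root_factored rG).
have locS : locate F G k.+1 = bisect F (locate F G k) by [].
rewrite locS /bisect /keep; split=> [i|H].
  have [H HG Hi] := IH1 i; have [rH _ _ _ _] := IH2 H HG.
  have [H' H'H H'i] := quarters_cover Hi.
  have [rH' _ _ _] := quartersP rH H'H.
  exists H' => //; rewrite mem_filter; apply/andP; split.
    by apply/(contains_root_factored rH'); exists i.
  by apply/flatten_mapP; exists H.
rewrite mem_filter => /andP[cH /flatten_mapP[H' H'G HH']].
have [rH' sub' xE yE _] := IH2 H' H'G.
have [rH sub xE' yE'] := quartersP rH' HH'.
split=> //.
- by move=> w /sub/sub'.
- by rewrite xE' xE exprSr invfM mulrA.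
- by rewrite yE' yE exprSr invfM mulrA.
- exact/(contains_root_factored rH).
Qed.

Lemma approx_rootsP G : is_rect G -> (forall i, in_rect G (z i)) ->
  forall eps : R, 0 < eps -> exists N : nat, forall k, (N <= k)%N ->
    (forall i, exists2 a, a \in approx_roots F G k & normc (a - z i) < eps) /\
    (forall a, a \in approx_roots F G k -> exists i, normc (a - z i) < eps).
Proof.
move=> rG zG eps eps0.
pose d := (xmax G - xmin G) + (ymax G - ymin G).
(* Archimedean bound: [2 ^+ k] exceeds [d / eps] from this [k] on. *)
exists (Num.bound (d / eps)) => k kN.
have dk : d / 2 ^+ k < eps.
  by rewrite ltr_pdivrMr ?exprn_gt0 // mulrC -ltr_pdivrMr //; exact: upper_nthrootP.
have [loc1 loc2] := locateP k rG zG.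
have near H i : H \in locate F G k -> in_rect H (z i) -> normc (Defs.center H - z i) < eps.
  move=> HG Hi; have [rH _ xE yE _] := loc2 H HG.
  apply: le_lt_trans (normc_center rH Hi) (le_lt_trans _ dk).
  have d0 : 0 <= d / 2 ^+ k.
    by rewrite divr_ge0 ?exprn_ge0 //; move: rG => /andP[? ?]; rewrite /d; lra.
  by rewrite xE yE -mulrDl -/d; lra.
split=> [i|_ /mapP[H HG ->]].
  have [H HG Hi] := loc1 i; exists (Defs.center H); last exact: near.
  exact: map_f.
by have [_ _ _ _ [i Hi]] := loc2 H HG; exists i; exact: near.
Qed.

End FactoredPolynomial.

(** The disk is open: small horizontal and vertical shifts of [w] in all four directions stay in it,
    hence in the rectangle. *)
Lemma interior_of_disk (rho : R) G w :
  (forall u, normc u < rho -> in_rect G u) -> normc w < rho -> in_interior G w.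
Proof.
move=> disk wr.
pose e := (rho - normc w) / 2.
have e0 : 0 < e by rewrite divr_gt0 // subr_gt0.
have near u : normc u = e -> in_rect G (w + u).
  move=> ue; apply: disk; apply: le_lt_trans (le_normcD _ _) _.
  by rewrite ue /e; lra.
have nr (t : R) : normc (t +i* 0) = `|t|.
  by rewrite /= expr0n addr0 sqrtr_sqr.
have ni (t : R) : normc (0 +i* t) = `|t|.
  by rewrite /= expr0n add0r sqrtr_sqr.
have := near (e +i* 0); have := near ((- e) +i* 0).
have := near (0 +i* e); have := near (0 +i* (- e)).
rewrite !nr !ni normrN gtr0_norm // => /(_ erefl) + /(_ erefl) + /(_ erefl) + /(_ erefl).
case: G w {disk near wr} @e e0 => x0 x1 y0 y1 [x y] e e0.
rewrite /in_rect /in_interior /=.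
move=> /andP[_ /andP[? ?]] /andP[_ /andP[? ?]] /andP[/andP[? ?] _] /andP[/andP[? ?] _].
lra.
Qed.

Lemma vertex_not_interior G v : v \in vertices G -> in_interior G v = false.
Proof.
rewrite /vertices /in_interior !inE.
by move=> /or4P[] /eqP->; rewrite /= !ltxx ?andbF.
Qed.

End Roots.

Theorem theorem1p8 (R : realType) (n : nat) (c : 'I_n -> R[i]) :
  let F : {poly R[i]} := 'X^n + \sum_(i < n) c i *: 'X^(n - i.+1) in
  exists z : 'I_n -> R[i],
    (* F splits *)
    F = \prod_(i < n) ('X - (z i)%:P)
    /\
    (* the winding number counts the roots in a rectangle *)
    (forall G : rect R, is_rect G ->
       (forall v, v \in vertices G -> F.[v] != 0) ->
       winding F G = \sum_(i < n) root_weight G (z i))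
    /\
    (* rectangles containing the Cauchy disk contain all the roots *)
    (forall G : rect R, is_rect G ->
       (forall w : R[i], Normc.normc w < cauchy_radius c -> in_rect G w) ->
       (forall i, in_rect G (z i)) /\ winding F G = n%:R)
    /\
    (* winding numbers are computed by Sturm chains *)
    (forall G : rect R, is_rect G -> winding F G = sturm_winding F G)
    /\
    (* the test of the algorithm recognizes the rectangles containing roots *)
    (forall G : rect R, is_rect G ->
       contains_root F G <-> exists i, in_rect G (z i))
    /\
    (* iterated bisection, started from a rectangle containing all the roots *)
    (forall G : rect R, is_rect G -> (forall i, in_rect G (z i)) ->
       (forall k,
          (forall i, exists2 H, H \in locate F G k & in_rect H (z i))
          /\
          (forall H, H \in locate F G k ->
             [/\ is_rect H,
                 forall w, in_rect H w -> in_rect G w,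
                 xmax H - xmin H = (xmax G - xmin G) / 2 ^+ k,
                 ymax H - ymin H = (ymax G - ymin G) / 2 ^+ k
               & exists i, in_rect H (z i)]))
       /\
       (forall eps : R, 0 < eps ->
          exists N : nat, forall k, (N <= k)%N ->
            (forall i, exists2 a, a \in approx_roots F G k &
                         Normc.normc (a - z i) < eps)
            /\
            (forall a, a \in approx_roots F G k ->
               exists i, Normc.normc (a - z i) < eps))).
Proof.
move=> F; have [z FE] := monic_split c; exists z.
have radius i : Normc.normc (z i) < cauchy_radius c.
  by apply: lt_cauchy_radius; rewrite FE; apply/eqP/root_factored; exists i.
rewrite -/F in FE; split=> //; rewrite FE.
split; first exact: winding_factored.
split.
  move=> G rG disk; split=> [i|]; first exact: disk.
  (* Interior roots all have weight 1, and none of them is a vertex, so the count is exactly [n]. *)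
  have inG i : in_interior G (z i) by exact: interior_of_disk disk (radius i).
  rewrite winding_factored // => [|v vG].
    under eq_bigr do rewrite /root_weight inG.
    by rewrite sumr_const card_ord.
  apply/negP => /root_factored[i iv].
  by have := vertex_not_interior vG; rewrite -iv inG.
split; first by move=> G _; exact: winding_sturm.
split; first exact: contains_root_factored.
move=> G rG zG; split; last exact: approx_rootsP.
by move=> k; exact: locateP.
Qed.
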